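(* Let $d\ge 1$ and $n_1,\dots,n_{2d}\ge 1$ be integers and let $\mathcal{F}\in\mathbb{R}^{n_1\times\cdots\times n_{2d}}$. The problem $$\max\ \mathcal{F}(x^1,x^2,\dots,x^{2d})\quad\text{s.t. } x^i\in\mathbb{R}^{n_i},\ \|x^i\|=1,\ i=1,\dots,2d,$$ is equivalent to its relaxation $$\max\ \mathcal{F}(x^1,x^2,\dots,x^{2d})\quad\text{s.t. } x^i\in\mathbb{R}^{n_i}\ (i=1,\dots,2d),\ \sqrt{\textstyle\sum_{i=1}^{2d}\|x^i\|^2}=\sqrt{2d},$$ in the sense that the relaxation is tight: the two problems have the same optimal value.
   Context: $\|\cdot\|$ is the Euclidean norm. For $\mathcal{F}\in\mathbb{R}^{n_1\times\cdots\times n_{2d}}$, the associated multilinear form is $\mathcal{F}(x^1,\dots,x^{2d})=\sum_{i_1,\dots,i_{2d}}\mathcal{F}_{i_1\cdots i_{2d}}\prod_{k=1}^{2d}x^k_{i_k}$. *)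

(* Defs.v *)
From HB Require Import structures.
From mathcomp Require Import all_boot all_order all_algebra.
From mathcomp Require Import all_classical all_reals.
Set Implicit Arguments.
Unset Strict Implicit.
Unset Printing Implicit Defensive.
Import Order.TTheory GRing.Theory Num.Theory.
Local Open Scope classical_set_scope.
Local Open Scope ring_scope.

Section Tensors.
Context {R : realType}.

(* [`|x|] on row vectors is the sup norm in MathComp-Analysis, hence this
   definition. *)
Definition enorm m (x : 'rV[R]_m) : R := Num.sqrt (\sum_(j < m) x 0 j ^+ 2).

(* The entries of a tensor of order [m] are indexed by the multi-indices
   [i = (i_k)_k] with [i k : 'I_(n k)]. *)
Definition tensor m (n : 'I_m -> nat) := {dffun forall k, 'I_(n k)} -> R.

Definition vectors m (n : 'I_m -> nat) := forall k : 'I_m, 'rV[R]_(n k).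

Definition multilinear_form m (n : 'I_m -> nat) (F : tensor n)
    (x : vectors n) : R :=
  \sum_(i : {dffun forall k, 'I_(n k)}) F i * \prod_(k < m) x k 0 (i k).

Definition multisphere m (n : 'I_m -> nat) : set (vectors n) :=
  [set x | forall k, enorm (x k) = 1].

Definition joint_sphere m (n : 'I_m -> nat) : set (vectors n) :=
  [set x | Num.sqrt (\sum_(k < m) enorm (x k) ^+ 2) = Num.sqrt m%:R].

(* [v] is the optimal value of the problem "max f(x) s.t. x in S"; as the
   problem is a maximum, [v] is required to be attained. *)
Definition is_max_value T (S : set T) (f : T -> R) (v : R) : Prop :=
  (exists2 x, S x & f x = v) /\ (forall x, S x -> f x <= v).

End Tensors.

Arguments tensor R {m} n.
Arguments vectors R {m} n.
Arguments multisphere R {m} n.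
Arguments joint_sphere R {m} n.

(* Main.v *)
Require Import Defs.
From HB Require Import structures.
From mathcomp Require Import all_boot all_order all_algebra.
From mathcomp Require Import all_classical all_reals.
From mathcomp Require Import topology normedtype derive.
Import numFieldNormedType.Exports.
Set Implicit Arguments.
Unset Strict Implicit.
Unset Printing Implicit Defensive.
Import Order.TTheory GRing.Theory Num.Theory.
Local Open Scope ring_scope.

(** The multisphere is a product of compact spheres, so the multilinear form [F]
    attains a maximum [v] on it. Flipping the sign of one vector negates [F], so
    [v >= 0]. If [x] satisfies the relaxed constraint, write each [x^k] as
    [||x^k||] times a unit vector [u^k]; then
    [F x = (\prod_k ||x^k||) * F u <= (\prod_k ||x^k||) * v], and the product of
    the norms is at most [1] by the AM-GM inequality. *)

Section EuclideanNorm.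
Context {R : realType}.

Lemma enorm_ge0 p (x : 'rV[R]_p) : 0 <= enorm x.
Proof. exact: sqrtr_ge0. Qed.

Lemma sqr_enorm p (x : 'rV[R]_p) : enorm x ^+ 2 = \sum_j x 0 j ^+ 2.
Proof. by rewrite sqr_sqrtr// sumr_ge0// => j _; rewrite sqr_ge0. Qed.

Lemma enormZ p (a : R) (x : 'rV[R]_p) : enorm (a *: x) = `|a| * enorm x.
Proof.
rewrite /enorm -sqrtr_sqr -sqrtrM ?sqr_ge0// mulr_sumr.
by under eq_bigr do rewrite mxE exprMn.
Qed.

Lemma enorm0_eq0 p (x : 'rV[R]_p) : enorm x = 0 -> x = 0.
Proof.
move=> x0; have /eqP : \sum_j x 0 j ^+ 2 = 0 by rewrite -sqr_enorm x0 expr0n.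
rewrite psumr_eq0 => [/allP xj0|j _]; last exact: sqr_ge0.
apply/rowP => j; rewrite mxE; apply/eqP; rewrite -sqrf_eq0.
exact: xj0 (mem_index_enum j).
Qed.

Lemma enorm_delta_mx p (j : 'I_p) : enorm (delta_mx 0 j : 'rV[R]_p) = 1.
Proof.
rewrite /enorm (bigD1 j)//= big1 ?mxE ?eqxx ?expr1n ?addr0 ?sqrtr1// => i ij.
by rewrite mxE (negbTE ij) andbF expr0n.
Qed.

(** Normalise [x] when it is nonzero. For [x = 0] any unit vector serves, and [0 < p] supplies a
    basis vector. *)
Lemma enorm_polar p (x : 'rV[R]_p) : (0 < p)%N ->
  exists2 u : 'rV[R]_p, enorm u = 1 & x = enorm x *: u.
Proof.
move=> p0; have [x0|x0] := eqVneq (enorm x) 0.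
  exists (delta_mx 0 (Ordinal p0)); first exact: enorm_delta_mx.
  by rewrite x0 scale0r; exact: enorm0_eq0.
exists ((enorm x)^-1 *: x); last by rewrite scalerA mulfV// scale1r.
by rewrite enormZ ger0_norm ?invr_ge0 ?enorm_ge0// mulVf.
Qed.

(** The sphere is a closed subset of the compact cube with sides [[-1, 1]]. *)
Lemma compact_unit_sphere p : compact [set x : 'rV[R]_p | enorm x = 1]%classic.
Proof.
apply: (subclosed_compact _
  (@rV_compact R p (fun=> `[(-1 : R), 1]%classic) _)).
(* Squaring the constraint makes the sphere the preimage of a closed point under a polynomial, which
   is continuous. *)
- have -> : [set x : 'rV[R]_p | enorm x = 1]%classic =
      ((fun x : 'rV[R]_p => \sum_j x 0 j ^+ 2) @^-1` [set (1 : R)])%classic.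
    apply/seteqP; split=> x /=; first by rewrite -sqr_enorm => ->; rewrite expr1n.
    by rewrite /enorm => ->; exact: sqrtr1.
  apply: preimage_closed; last exact: closed_eq.
  move=> x _; move: x; apply: continuous_big => [|j _]; first exact: add_continuous.
  by move=> x; apply: continuousM; exact: coord_continuous.
- by move=> _; exact: segment_compact.
- move=> x /= x1 j; rewrite in_itv/= -ler_norml.
(* Each squared coordinate is one term of a nonnegative sum equal to 1. *)
rewrite -(@expr_le1 _ 2)// real_normK ?num_real// -(expr1n R 2) -x1 sqr_enorm.
by rewrite (bigD1 j)//= lerDl sumr_ge0// => i _; rewrite sqr_ge0.
Qed.

End EuclideanNorm.

Section MultilinearForm.
Context {R : realType} {m : nat} {n : 'I_m -> nat}.
Implicit Types (F : tensor R n) (x : vectors R n).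

Lemma multilinear_formZ F (c : 'I_m -> R) x :
  multilinear_form F (fun k => c k *: x k) =
  (\prod_k c k) * multilinear_form F x.
Proof.
rewrite /multilinear_form mulr_sumr; apply: eq_bigr => i _.
by rewrite mulrCA -big_split; congr (_ * _); apply: eq_bigr => k _; rewrite mxE.
Qed.

Lemma multilinear_form_max_attained F : (forall k, (0 < n k)%N) ->
  exists v, is_max_value (multisphere R n) (multilinear_form F) v.
Proof.
move=> n0.
(* Families of vectors are given the product topology: the multisphere is compact by Tychonoff, and
   the form is continuous as a finite sum of products of coordinates. *)
have [] := @compact_EVT_max (prod_topology (fun k => 'rV[R]_(n k))) R
  (multilinear_form F) (multisphere R n).
- exists (fun k => delta_mx 0 (Ordinal (n0 k))) => k; exact: enorm_delta_mx.
- exact: (@tychonoff _ (fun k => 'rV[R]_(n k))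
    (fun k => [set y | enorm y = 1]%classic) (fun k => @compact_unit_sphere R (n k))).
- apply: continuous_subspaceT.
  apply: continuous_big => [|i _]; first exact: add_continuous.
  move=> x; apply: continuousM; first exact: cst_continuous.
  move: x; apply: continuous_big => [|k _]; first exact: mul_continuous.
  move=> x; apply: (@continuous_comp _ _ _
    (proj k : prod_topology (fun k => 'rV[R]_(n k)) -> 'rV[R]_(n k))
    (fun y => y 0 (i k))); first exact: proj_continuous.
  exact: coord_continuous.
move=> x /set_mem Sx xmax; exists (multilinear_form F x).
by split=> [|y Sy]; [exists x | exact/xmax/mem_set].
Qed.

Lemma multisphere_max_ge0 F v : (0 < m)%N ->
  is_max_value (multisphere R n) (multilinear_form F) v -> 0 <= v.
Proof.
(* Negating the first vector of a maximiser [x] stays on the multisphere, so [- F x <= F x], that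
   is, [0 <= 2 * F x]. *)
move=> m0 [[x Sx <-] xmax].
pose c (k : 'I_m) : R := if k == Ordinal m0 then -1 else 1.
have := xmax (fun k => c k *: x k); rewrite multilinear_formZ.
rewrite (bigD1 (Ordinal m0))//= big1 => [|k /negbTE k0]; last by rewrite /c k0.
rewrite /c eqxx mulr1 mulN1r -subr_ge0 opprK -mulr2n pmulrn_lge0//.
by apply=> k; rewrite enormZ Sx mulr1; case: ifP; rewrite ?normrN normr1.
Qed.

Lemma joint_sphere_prod_enorm_le1 x : (0 < m)%N ->
  joint_sphere R n x -> \prod_k enorm (x k) <= 1.
Proof.
move=> m0 /eqP; rewrite eqr_sqrt ?ler0n//; last first.
  by rewrite sumr_ge0// => k _; rewrite sqr_ge0.
move=> /eqP sum_m.
(* AM-GM is applied to the squared norms, whose mean is [m / m = 1]; it bounds the square of the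
   wanted product by 1. *)
have := (@leif_AGM _ _ 'I_m (fun k => enorm (x k) ^+ 2)
  (fun k _ => sqr_ge0 _)).1.
rewrite card_ord sum_m divff ?pnatr_eq0 -?lt0n// expr1n prodrXl.
by rewrite expr_le1// prodr_ge0// => k _; exact: enorm_ge0.
Qed.

Lemma multisphere_sub_joint_sphere : (multisphere R n `<=` joint_sphere R n)%classic.
Proof.
move=> x Sx; rewrite /joint_sphere/=; congr Num.sqrt.
by under eq_bigr do rewrite Sx expr1n; rewrite sumr_const card_ord.
Qed.

Lemma joint_sphere_max F v : (0 < m)%N -> (forall k, (0 < n k)%N) ->
  is_max_value (multisphere R n) (multilinear_form F) v ->
  is_max_value (joint_sphere R n) (multilinear_form F) v.
Proof.
move=> m0 n0 vmax; have v0 := multisphere_max_ge0 m0 vmax.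
case: vmax => [[x Sx Fx] ubv]; split.
  by exists x => //; exact: multisphere_sub_joint_sphere.
(* A unit direction [u k] is chosen for every [y k], including those that vanish. *)
move=> y Jy; have /(_ _)/cid2 u_ k := enorm_polar (y k) (n0 k).
pose u k := s2val (u_ k).
have -> : y = (fun k => enorm (y k) *: u k).
  by apply: functional_extensionality_dep => k; exact: s2valP' (u_ k).
(* With [P] the product of the norms, [F y = P * F u <= P * v <= v]: the first inequality uses
   [0 <= P], the second [P <= 1] together with [0 <= v]. *)
rewrite multilinear_formZ (le_trans (ler_wpM2l _ (ubv u _)))//.
- by rewrite prodr_ge0// => k _; exact: enorm_ge0.
- by move=> k; exact: s2valP (u_ k).
- by rewrite ler_piMl// joint_sphere_prod_enorm_le1.
Qed.

End MultilinearForm.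

Theorem proposition8p3 (R : realType) (d : nat) (hd : (1 <= d)%N)
    (n : 'I_(2 * d) -> nat) (hn : forall k, (1 <= n k)%N) (F : tensor R n) :
  exists v : R,
    is_max_value (multisphere R n) (multilinear_form F) v /\
    is_max_value (joint_sphere R n) (multilinear_form F) v.
Proof.
have [v vmax] := multilinear_form_max_attained F hn.
exists v; split=> //; apply: joint_sphere_max => //.
by rewrite muln_gt0.
Qed.
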